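(* Let $M$ be a program. The abstract alternating machine $\mathcal{K}_{\mathcal{B}}$ accepts $M$ if and only if the $\beta\delta$-normal form of $M$ is $T$.
   Context: $\Lambda_B$ terms: $t,u,v::=x\mid F\mid T\mid \lambda x.t\mid t\,u\mid \mathrm{if}\ t\ \mathrm{then}\ u\ \mathrm{else}\ v$, with $\beta$-reduction and $\delta$-reduction (contextual closure of $(\mathrm{if}\ T\ \mathrm{then}\ u\ \mathrm{else}\ v)\to u$, $(\mathrm{if}\ F\ \mathrm{then}\ u\ \mathrm{else}\ v)\to v$). Types of $\mathbf{DLAL_B}$: $A,B::=\alpha\mid A\multimap B\mid A\Rightarrow B\mid \S A\mid \forall\alpha.A\mid \mathbf{Bool}$, judgements $\Gamma;\Delta\vdash t:A$ ($\Gamma$ non-linear, $\Delta$ linear variable declarations, disjoint). Rules: (Id) $;x:A\vdash x:A$. ($\multimap$i) from $\Gamma;\Delta,x:A\vdash t:B$ infer $\Gamma;\Delta\vdash\lambda x.t:A\multimap B$. ($\multimap$e) from $\Gamma_1;\Delta_1\vdash t:A\multimap B$ and $\Gamma_2;\Delta_2\vdash u:A$ infer $\Gamma_1,\Gamma_2;\Delta_1,\Delta_2\vdash t\,u:B$. ($\Rightarrow$i) from $\Gamma,x:A;\Delta\vdash t:B$ infer $\Gamma;\Delta\vdash \lambda x.t:A\Rightarrow B$. ($\Rightarrow$e) from $\Gamma;\Delta\vdash t:A\Rightarrow B$ and $;z:C\vdash u:A$ infer $\Gamma,z:C;\Delta\vdash t\,u:B$ (right premise may also be $;\vdash u:A$,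 conclusion $\Gamma;\Delta\vdash t\,u:B$). (Weak) from $\Gamma_1;\Delta_1\vdash t:A$ infer $\Gamma_1,\Gamma_2;\Delta_1,\Delta_2\vdash t:A$. (Cntr) from $x_1:A,x_2:A,\Gamma;\Delta\vdash t:B$ infer $x:A,\Gamma;\Delta\vdash t[x/x_1,x/x_2]:B$. ($\S$i) from $;\Gamma,\Delta\vdash t:A$ infer $\Gamma;\S\Delta\vdash t:\S A$. ($\S$e) from $\Gamma_1;\Delta_1\vdash u:\S A$ and $\Gamma_2;x:\S A,\Delta_2\vdash t:B$ infer $\Gamma_1,\Gamma_2;\Delta_1,\Delta_2\vdash t[u/x]:B$. ($\forall$i) from $\Gamma;\Delta\vdash t:A$ infer $\Gamma;\Delta\vdash t:\forall\alpha.A$ if $\alpha$ not free in $\Gamma,\Delta$. ($\forall$e) from $\Gamma;\Delta\vdash t:\forall\alpha.A$ infer $\Gamma;\Delta\vdash t:A[B/\alpha]$. ($B_0$i) $;\vdash F:\mathbf{Bool}$; ($B_1$i) $;\vdash T:\mathbf{Bool}$. ($B$e) from $\Gamma;\Delta\vdash M_0:\S^k\mathbf{Bool}$, $\Gamma;\Delta\vdash M_1:A$, $\Gamma;\Delta\vdash M_2:A$ infer $\Gamma;\Delta\vdash \mathrm{if}\ M_0\ \mathrm{then}\ M_1\ \mathrm{else}\ M_2:A$. A program is a term $M$ with $;\vdash M:\S^n\mathbf{Bool}$ for some $n\in\mathbb{N}$ (it has a unique $\beta\delta$-normal form). Machine $\mathcal{K}_{\mathcal{B}}$. A context $\mathcal{A}$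 is a finite sequence of assignments $x_i:=t_i$ with distinct $x_i$; $\emptyset$ is the empty one and $@$ denotes concatenation. Configurations: $[\![\mathrm{Rejecting}]\!]$, $[\![\mathrm{Accepting}]\!]$, existential $[\![(\exists)\,\mathcal{A}\mid\{b;t\}]\!]$ and universal $[\![(\forall)\,\mathcal{A}\mid\{b;t\}\{b';t'\}]\!]$ with $b,b'\in\{yes,no\}$. Every term is uniquely $N_0N_1\cdots N_p$ with $N_0$ a variable, abstraction, if-term or constant. Transitions: ($\beta$) $[\![(\exists)\mathcal{A}\mid\{b;(\lambda x.N)N_1\cdots N_p\}]\!]\to[\![(\exists)\mathcal{A}@(x':=N_1)\mid\{b;N[x'/x]N_2\cdots N_p\}]\!]$, $x'$ fresh; ($h$) $[\![(\exists)\mathcal{A}_1@(x:=N)@\mathcal{A}_2\mid\{b;x N_1\cdots N_p\}]\!]\to[\![(\exists)\mathcal{A}_1@(x:=N)@\mathcal{A}_2\mid\{b;N N_1\cdots N_p\}]\!]$; ($if$) $[\![(\exists)\mathcal{A}\mid\{b;(\mathrm{if}\ M_0\ \mathrm{then}\ M_1\ \mathrm{else}\ M_2)N_1\cdots N_p\}]\!]$ has successors $[\![(\forall)\mathcal{A}\mid\{yes;M_0\}\{b;M_1N_1\cdots N_p\}]\!]$ and $[\![(\forall)\mathcal{A}\mid\{no;M_0\}\{b;M_2N_1\cdots N_p\}]\!]$; ($if'$) $[\![(\forall)\mathcal{A}\mid\{a;M_0\}\{b;N\}]\!]$ has successors $[\![(\exists)\mathcal{A}\mid\{a;M_0\}]\!]$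 and $[\![(\exists)\mathcal{A}\mid\{b;N\}]\!]$; base cases: $[\![(\exists)\mathcal{A}\mid\{yes;T\}]\!]$, $[\![(\exists)\mathcal{A}\mid\{no;F\}]\!]\to[\![\mathrm{Accepting}]\!]$ and $[\![(\exists)\mathcal{A}\mid\{no;T\}]\!]$, $[\![(\exists)\mathcal{A}\mid\{yes;F\}]\!]\to[\![\mathrm{Rejecting}]\!]$. Initial configuration on input $M$: $[\![(\exists)\emptyset\mid\{yes;M\}]\!]$; acceptance is as for alternating Turing machines (existential: some successor accepted; universal: all successors accepted; Accepting accepted, Rejecting not), and $\mathcal{K}_{\mathcal{B}}$ accepts $M$ iff the initial configuration is accepted. *)

(* Defs.v *)
From HB Require Import structures.
From mathcomp Require Import all_boot.
From Stdlib Require Import Relations.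

Set Implicit Arguments.
Unset Strict Implicit.
Unset Printing Implicit Defensive.

(* Terms and types are represented in locally nameless style: free variables
   are named, bound variables are de Bruijn indices.  The terms of the calculus
   up to alpha-equivalence are the [pterm]s satisfying [lc], and likewise the
   types are the [ty]s satisfying [tlc]. *)

Definition var := nat.

Inductive pterm : Type :=
  | Bvar of nat
  | Var of var
  | F
  | T
  | Lam of pterm
  | App of pterm & pterm
  | If of pterm & pterm & pterm.

Fixpoint lc_at (k : nat) (t : pterm) : bool :=
  match t with
  | Bvar i => i < k
  | Var _ | F | T => true
  | Lam t => lc_at k.+1 t
  | App t u => lc_at k t && lc_at k u
  | If t u v => [&& lc_at k t, lc_at k u & lc_at k v]
  end.

Definition lc (t : pterm) : bool := lc_at 0 t.

Fixpoint fv (t : pterm) : seq var :=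
  match t with
  | Var x => [:: x]
  | Bvar _ | F | T => [::]
  | Lam t => fv t
  | App t u => fv t ++ fv u
  | If t u v => fv t ++ fv u ++ fv v
  end.

(* [open_at] and [subst] insert [u] without shifting, which is capture-avoiding
   whenever [lc u]. *)
Fixpoint open_at (k : nat) (u t : pterm) : pterm :=
  match t with
  | Bvar i => if i == k then u else Bvar i
  | Var x => Var x
  | F => F
  | T => T
  | Lam t => Lam (open_at k.+1 u t)
  | App t1 t2 => App (open_at k u t1) (open_at k u t2)
  | If t0 t1 t2 => If (open_at k u t0) (open_at k u t1) (open_at k u t2)
  end.

(* If [t] is the body of an abstraction [Lam t] on x, this is t[u/x]. *)
Definition open (t u : pterm) : pterm := open_at 0 u t.

Fixpoint close_at (k : nat) (x : var) (t : pterm) : pterm :=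
  match t with
  | Bvar i => Bvar i
  | Var y => if y == x then Bvar k else Var y
  | F => F
  | T => T
  | Lam t => Lam (close_at k.+1 x t)
  | App t1 t2 => App (close_at k x t1) (close_at k x t2)
  | If t0 t1 t2 => If (close_at k x t0) (close_at k x t1) (close_at k x t2)
  end.

(* lambda x. t *)
Definition abs (x : var) (t : pterm) : pterm := Lam (close_at 0 x t).

(* t[u/x] *)
Fixpoint subst (x : var) (u t : pterm) : pterm :=
  match t with
  | Bvar i => Bvar i
  | Var y => if y == x then u else Var y
  | F => F
  | T => T
  | Lam t => Lam (subst x u t)
  | App t1 t2 => App (subst x u t1) (subst x u t2)
  | If t0 t1 t2 => If (subst x u t0) (subst x u t1) (subst x u t2)
  end.

(* N_0 N_1 ... N_p *)
Definition apps (t : pterm) (s : seq pterm) : pterm := foldl App t s.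

Inductive beta_redex : pterm -> pterm -> Prop :=
  | BetaRedex t u : lc (Lam t) -> lc u ->
      beta_redex (App (Lam t) u) (open t u).

Inductive delta_redex : pterm -> pterm -> Prop :=
  | DeltaRedexT u v : lc u -> lc v -> delta_redex (If T u v) u
  | DeltaRedexF u v : lc u -> lc v -> delta_redex (If F u v) v.

Inductive ctx_closure (R : pterm -> pterm -> Prop) : pterm -> pterm -> Prop :=
  | CcBase t t' : R t t' -> ctx_closure R t t'
  | CcLam x t t' : ctx_closure R t t' -> ctx_closure R (abs x t) (abs x t')
  | CcAppL t t' u : ctx_closure R t t' -> lc u ->
      ctx_closure R (App t u) (App t' u)
  | CcAppR t u u' : lc t -> ctx_closure R u u' ->
      ctx_closure R (App t u) (App t u')
  | CcIf0 t t' u v : ctx_closure R t t' -> lc u -> lc v ->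
      ctx_closure R (If t u v) (If t' u v)
  | CcIf1 t u u' v : lc t -> ctx_closure R u u' -> lc v ->
      ctx_closure R (If t u v) (If t u' v)
  | CcIf2 t u v v' : lc t -> lc u -> ctx_closure R v v' ->
      ctx_closure R (If t u v) (If t u v').

Definition beta : pterm -> pterm -> Prop := ctx_closure beta_redex.
Definition delta : pterm -> pterm -> Prop := ctx_closure delta_redex.
Definition betadelta (t u : pterm) : Prop := beta t u \/ delta t u.
Definition betadelta_star : pterm -> pterm -> Prop :=
  clos_refl_trans pterm betadelta.

Definition normal (t : pterm) : Prop := forall u, ~ betadelta t u.

Definition is_normal_form_of (N M : pterm) : Prop :=
  betadelta_star M N /\ normal N.

Inductive ty : Type :=
  | TBvar of nat
  | TVar of nat
  | Lin of ty & ty      (* A -o B *)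
  | Arr of ty & ty      (* A => B *)
  | Par of ty           (* the paragraph modality *)
  | All of ty
  | Bool.

Definition ty_eq_dec : comparable ty.
Proof. by move=> A B; rewrite /decidable; repeat decide equality. Defined.
HB.instance Definition _ := hasDecEq.Build ty (compareP ty_eq_dec).

Fixpoint tlc_at (k : nat) (A : ty) : bool :=
  match A with
  | TBvar i => i < k
  | TVar _ | Bool => true
  | Lin A B | Arr A B => tlc_at k A && tlc_at k B
  | Par A => tlc_at k A
  | All A => tlc_at k.+1 A
  end.

Definition tlc (A : ty) : bool := tlc_at 0 A.

Fixpoint ftv (A : ty) : seq nat :=
  match A with
  | TVar a => [:: a]
  | TBvar _ | Bool => [::]
  | Lin A B | Arr A B => ftv A ++ ftv B
  | Par A => ftv A
  | All A => ftv A
  end.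

Fixpoint topen_at (k : nat) (C A : ty) : ty :=
  match A with
  | TBvar i => if i == k then C else TBvar i
  | TVar a => TVar a
  | Lin A B => Lin (topen_at k C A) (topen_at k C B)
  | Arr A B => Arr (topen_at k C A) (topen_at k C B)
  | Par A => Par (topen_at k C A)
  | All A => All (topen_at k.+1 C A)
  | Bool => Bool
  end.

(* If [A] is the body of a quantification [All A] on alpha, this is
   A[C/alpha]. *)
Definition topen (A C : ty) : ty := topen_at 0 C A.

Fixpoint tclose_at (k : nat) (a : nat) (A : ty) : ty :=
  match A with
  | TBvar i => TBvar i
  | TVar b => if b == a then TBvar k else TVar b
  | Lin A B => Lin (tclose_at k a A) (tclose_at k a B)
  | Arr A B => Arr (tclose_at k a A) (tclose_at k a B)
  | Par A => Par (tclose_at k a A)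
  | All A => All (tclose_at k.+1 a A)
  | Bool => Bool
  end.

(* forall a. A *)
Definition forall_ty (a : nat) (A : ty) : ty := All (tclose_at 0 a A).

Definition decls := seq (var * ty).

Definition valid (G D : decls) : bool :=
  uniq (unzip1 (G ++ D)) && all tlc (unzip2 (G ++ D)).

Definition par_decls (D : decls) : decls := [seq (d.1, Par d.2) | d <- D].

(* Declarations are unordered ([Ty_exch]); the [valid] premises express that
   the declarations of the conclusion are about distinct variables. *)
Inductive typing : decls -> decls -> pterm -> ty -> Prop :=
  | Ty_exch G G' D D' t A :
      perm_eq G G' -> perm_eq D D' ->
      typing G D t A ->
      typing G' D' t A
  | Ty_id x A :
      tlc A ->
      typing [::] [:: (x, A)] (Var x) A
  | Ty_lin_i G D x A t B :
      typing G (rcons D (x, A)) t B ->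
      typing G D (abs x t) (Lin A B)
  | Ty_lin_e G1 G2 D1 D2 t u A B :
      valid (G1 ++ G2) (D1 ++ D2) ->
      typing G1 D1 t (Lin A B) ->
      typing G2 D2 u A ->
      typing (G1 ++ G2) (D1 ++ D2) (App t u) B
  | Ty_arr_i G D x A t B :
      typing (rcons G (x, A)) D t B ->
      typing G D (abs x t) (Arr A B)
  | Ty_arr_e G D z C t u A B :
      valid (rcons G (z, C)) D ->
      typing G D t (Arr A B) ->
      typing [::] [:: (z, C)] u A ->
      typing (rcons G (z, C)) D (App t u) B
  | Ty_arr_e0 G D t u A B :
      typing G D t (Arr A B) ->
      typing [::] [::] u A ->
      typing G D (App t u) B
  | Ty_weak G1 G2 D1 D2 t A :
      valid (G1 ++ G2) (D1 ++ D2) ->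
      typing G1 D1 t A ->
      typing (G1 ++ G2) (D1 ++ D2) t A
  | Ty_cntr G D x x1 x2 A t B :
      valid ((x, A) :: G) D ->
      typing [:: (x1, A), (x2, A) & G] D t B ->
      typing ((x, A) :: G) D (subst x2 (Var x) (subst x1 (Var x) t)) B
  | Ty_par_i G D t A :
      typing [::] (G ++ D) t A ->
      typing G (par_decls D) t (Par A)
  | Ty_par_e G1 G2 D1 D2 x t u A B :
      valid (G1 ++ G2) (D1 ++ D2) ->
      typing G1 D1 u (Par A) ->
      typing G2 ((x, Par A) :: D2) t B ->
      typing (G1 ++ G2) (D1 ++ D2) (subst x u t) B
  | Ty_all_i G D a t A :
      all (fun d => a \notin ftv d.2) (G ++ D) ->
      typing G D t A ->
      typing G D t (forall_ty a A)
  | Ty_all_e G D t A B :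
      tlc B ->
      typing G D t (All A) ->
      typing G D t (topen A B)
  | Ty_F : typing [::] [::] F Bool
  | Ty_T : typing [::] [::] T Bool
  | Ty_if G D k M0 M1 M2 A :
      typing G D M0 (iter k Par Bool) ->
      typing G D M1 A ->
      typing G D M2 A ->
      typing G D (If M0 M1 M2) A.

Definition program (M : pterm) : Prop :=
  exists n : nat, typing [::] [::] M (iter n Par Bool).

Record context : Type := Context {
  assigns :> seq (var * pterm);
  assigns_uniq : uniq (unzip1 assigns) }.

Definition empty_context : context := @Context [::] isT.

Inductive answer : Type := yes | no.

Inductive config : Type :=
  | Rejecting
  | Accepting
  | Ex of context & answer & pterm
  | Un of context & answer & pterm & answer & pterm.

Definition existential (c : config) : Prop :=
  if c is Ex _ _ _ then True else False.

Definition universal (c : config) : Prop :=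
  if c is Un _ _ _ _ _ then True else False.

Definition fresh (x : var) (A : context) (t : pterm) : bool :=
  (x \notin fv t) && all (fun a => (x != a.1) && (x \notin fv a.2)) A.

Inductive step : config -> config -> Prop :=
  | StepBeta (A A' : context) b x' N N1 s :
      fresh x' A (apps (Lam N) (N1 :: s)) ->
      assigns A' = A ++ [:: (x', N1)] ->
      step (Ex A b (apps (Lam N) (N1 :: s)))
           (Ex A' b (apps (open N (Var x')) s))
  | StepH (A : context) A1 A2 x N b s :
      assigns A = A1 ++ [:: (x, N)] ++ A2 ->
      step (Ex A b (apps (Var x) s)) (Ex A b (apps N s))
  | StepIfYes A b M0 M1 M2 s :
      step (Ex A b (apps (If M0 M1 M2) s)) (Un A yes M0 b (apps M1 s))
  | StepIfNo A b M0 M1 M2 s :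
      step (Ex A b (apps (If M0 M1 M2) s)) (Un A no M0 b (apps M2 s))
  | StepIf'L A a M0 b N : step (Un A a M0 b N) (Ex A a M0)
  | StepIf'R A a M0 b N : step (Un A a M0 b N) (Ex A b N)
  | StepYesT A : step (Ex A yes T) Accepting
  | StepNoF A : step (Ex A no F) Accepting
  | StepNoT A : step (Ex A no T) Rejecting
  | StepYesF A : step (Ex A yes F) Rejecting.

Inductive accepted : config -> Prop :=
  | AccAccepting : accepted Accepting
  | AccExistential c c' :
      existential c -> step c c' -> accepted c' -> accepted c
  | AccUniversal c :
      universal c -> (forall c', step c c' -> accepted c') -> accepted c.

Definition machine_accepts (M : pterm) : Prop :=
  accepted (Ex empty_context yes M).

(* Main.v *)
Require Import Defs.
From HB Require Import structures.
From mathcomp Require Import all_boot.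
From Stdlib Require Import Relations.

Set Implicit Arguments.
Unset Strict Implicit.
Unset Printing Implicit Defensive.

(** A run of the machine from [Ex A b t] follows the weak head evaluation of
    the term [t[A]] obtained by unfolding all the assignments of [A]: steps (h)
    leave [t[A]] unchanged, steps (beta) contract its head redex, and the two
    branches of an (if) step evaluate the condition and the selected branch.
    So acceptance is equivalent to [eval (t[A]) b], where [eval] is a big-step
    weak head evaluation.  That [eval] is complete for beta-delta reduction to
    a constant is the standardization theorem. *)

(** * Locally closed terms, substitution and opening *)

Lemma lc_at_leq k k' t : k <= k' -> lc_at k t -> lc_at k' t.
Proof.
elim: t k k' => //=.
- by move=> n k k' kk' nk; apply: leq_trans kk'.
- by move=> t IHt k k' kk'; apply: IHt.
- move=> t IHt u IHu k k' kk' /andP[ht hu].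
  by rewrite (IHt _ _ kk' ht) (IHu _ _ kk' hu).
- move=> t IHt u IHu v IHv k k' kk' /and3P[ht hu hv].
  by rewrite (IHt _ _ kk' ht) (IHu _ _ kk' hu) (IHv _ _ kk' hv).
Qed.

Lemma lc_lc_at k t : lc t -> lc_at k t.
Proof. exact: lc_at_leq. Qed.

Lemma lc_at_close k x t : lc_at k t -> lc_at k.+1 (close_at k x t).
Proof.
elim: t k => //=.
- by move=> n k nk; apply: ltnW.
- by move=> y k _; case: (y == x) => /=.
- by move=> t IHt k; apply: IHt.
- by move=> t IHt u IHu k /andP[/IHt-> /IHu->].
- by move=> t IHt u IHu v IHv k /and3P[/IHt-> /IHu-> /IHv->].
Qed.

Lemma lc_abs x t : lc t -> lc (abs x t).
Proof. exact: lc_at_close. Qed.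

Lemma lc_at_subst k x u t : lc u -> lc_at k t -> lc_at k (subst x u t).
Proof.
move=> lcu; elim: t k => //=.
- by move=> y k _; case: (y == x) => //=; apply: lc_lc_at.
- by move=> t IHt k; apply: IHt.
- by move=> t IHt v IHv k /andP[/IHt-> /IHv->].
- by move=> t IHt v IHv w IHw k /and3P[/IHt-> /IHv-> /IHw->].
Qed.

Lemma lc_subst x u t : lc u -> lc t -> lc (subst x u t).
Proof. exact: lc_at_subst. Qed.

Lemma lc_at_open k u t : lc u -> lc_at k.+1 t -> lc_at k (open_at k u t).
Proof.
move=> lcu; elim: t k => //=.
- move=> n k; rewrite ltnS leq_eqVlt; case: eqP => /= [_ _|_ //].
  exact: lc_lc_at.
- by move=> t IHt k; apply: IHt.
- by move=> t IHt v IHv k /andP[/IHt-> /IHv->].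
- by move=> t IHt v IHv w IHw k /and3P[/IHt-> /IHv-> /IHw->].
Qed.

Lemma lc_open t u : lc (Lam t) -> lc u -> lc (open t u).
Proof. by move=> lct lcu; apply: lc_at_open. Qed.

(** The opened variable can only stand for index [k], so one opening is enough to bound the indices
    of a body. This recovers closure of an abstraction from a cofinite premise. *)
Lemma lc_at_open_var k x t : lc_at k (open_at k (Var x) t) -> lc_at k.+1 t.
Proof.
elim: t k => //=.
- move=> n k; case: eqP => [->|_] //=; exact: ltnW.
- by move=> t IHt k; apply: IHt.
- by move=> t IHt v IHv k /andP[/IHt-> /IHv->].
- by move=> t IHt v IHv w IHw k /and3P[/IHt-> /IHv-> /IHw->].
Qed.

Lemma open_at_lc k u t : lc_at k t -> open_at k u t = t.
Proof.
elim: t k => //=.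
- by move=> n k nk; rewrite ltn_eqF.
- by move=> t IHt k /IHt->.
- by move=> t IHt v IHv k /andP[/IHt-> /IHv->].
- by move=> t IHt v IHv w IHw k /and3P[/IHt-> /IHv-> /IHw->].
Qed.

Lemma subst_open_at k x u t v : lc u ->
  subst x u (open_at k v t) = open_at k (subst x u v) (subst x u t).
Proof.
move=> lcu; elim: t k => //=.
- by move=> n k; case: eqP.
- by move=> y k; case: eqP => // _; rewrite open_at_lc // lc_lc_at.
- by move=> t IHt k; rewrite IHt.
- by move=> t IHt w IHw k; rewrite IHt IHw.
- by move=> t IHt w IHw z IHz k; rewrite IHt IHw IHz.
Qed.

Lemma subst_open x u t v : lc u ->
  subst x u (open t v) = open (subst x u t) (subst x u v).
Proof. exact: subst_open_at. Qed.

Lemma subst_open_var x y u t : lc u -> x != y ->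
  subst x u (open t (Var y)) = open (subst x u t) (Var y).
Proof. by move=> lcu /negPf xy; rewrite subst_open //= eq_sym xy. Qed.

Lemma subst_fresh x u t : x \notin fv t -> subst x u t = t.
Proof.
elim: t => //=.
- by move=> y; rewrite inE eq_sym => /negPf->.
- by move=> t IHt /IHt->.
- by move=> t IHt v IHv; rewrite mem_cat negb_or => /andP[/IHt-> /IHv->].
- move=> t IHt v IHv w IHw; rewrite !mem_cat !negb_or.
  by case/and3P=> /IHt-> /IHv-> /IHw->.
Qed.

(** Lets a cofinite premise, which speaks of opening with variables, be used for an arbitrary
    argument: open with a fresh name, then substitute for it. *)
Lemma open_subst x u t : lc u -> x \notin fv t ->
  open t u = subst x u (open t (Var x)).
Proof. by move=> lcu xt; rewrite subst_open //= eqxx subst_fresh. Qed.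

Lemma open_close_at k x z t : lc_at k t ->
  open_at k (Var z) (close_at k x t) = subst x (Var z) t.
Proof.
elim: t k => //=.
- by move=> n k nk; rewrite ltn_eqF.
- by move=> y k _; case: (y == x); rewrite /= ?eqxx.
- by move=> t IHt k /IHt->.
- by move=> t IHt v IHv k /andP[/IHt-> /IHv->].
- by move=> t IHt v IHv w IHw k /and3P[/IHt-> /IHv-> /IHw->].
Qed.

Lemma open_close x z t : lc t ->
  open (close_at 0 x t) (Var z) = subst x (Var z) t.
Proof. exact: open_close_at. Qed.

Definition pterm_eq_dec : comparable pterm.
Proof. by move=> t u; rewrite /decidable; repeat decide equality. Defined.
HB.instance Definition _ := hasDecEq.Build pterm (compareP pterm_eq_dec).

Definition new (L : seq var) : var := (\max_(x <- L) x).+1.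

Lemma new_notin L : new L \notin L.
Proof.
apply/negP=> nL; suff : new L <= \max_(x <- L) x by rewrite ltnn.
exact: (leq_bigmax_seq (F := id)).
Qed.

(** Supplies the local closure of programs, on which standardization and the unfolding of contexts
    rely. *)
Lemma typing_lc G D t A : typing G D t A -> lc t.
Proof.
elim=> //=.
- by move=> *; apply: lc_abs.
- by move=> *; apply/andP.
- by move=> *; apply: lc_abs.
- by move=> *; apply/andP.
- by move=> *; apply/andP.
- by move=> *; do 2!apply: lc_subst => //.
- by move=> *; apply: lc_subst.
- by move=> *; apply/and3P.
Qed.

(** * Applicative spines *)

Fixpoint term_head (t : pterm) : pterm := if t is App u _ then term_head u else t.

Fixpoint term_args (t : pterm) : seq pterm :=
  if t is App u v then rcons (term_args u) v else [::].

Definition is_app (t : pterm) : bool := if t is App _ _ then true else false.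

Definition is_var (t : pterm) : bool := if t is Var _ then true else false.

Lemma apps_rcons t s u : apps t (rcons s u) = App (apps t s) u.
Proof. exact: foldl_rcons. Qed.

Lemma apps_head_args t : apps (term_head t) (term_args t) = t.
Proof. by elim: t => //= t IHt u _; rewrite apps_rcons IHt. Qed.

Lemma head_apps t s : term_head (apps t s) = term_head t.
Proof. by elim: s t => //= u s IHs t; rewrite IHs. Qed.

Lemma args_apps t s : term_args (apps t s) = term_args t ++ s.
Proof.
elim: s t => [|u s IHs] t /=; first by rewrite cats0.
by rewrite IHs /= cat_rcons.
Qed.

Lemma head_not_app t : ~~ is_app (term_head t).
Proof. by elim: t. Qed.

Lemma head_id t : ~~ is_app t -> term_head t = t.
Proof. by case: t. Qed.

Lemma args_nil t : ~~ is_app t -> term_args t = [::].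
Proof. by case: t. Qed.

(** The decomposition into head and arguments is unique because [term_head] and [term_args] compute
    both from the term. *)
Lemma apps_inj h s h' s' : ~~ is_app h -> ~~ is_app h' ->
  apps h s = apps h' s' -> h = h' /\ s = s'.
Proof.
move=> nh nh' e; split.
- by rewrite -[h]head_id // -(head_apps h s) e head_apps head_id.
- have := congr1 term_args e.
  by rewrite !args_apps (args_nil nh) (args_nil nh').
Qed.

Lemma lc_apps t s : lc (apps t s) = lc t && all lc s.
Proof.
elim: s t => [|u s IHs] t /=; first by rewrite andbT.
by rewrite IHs /= andbA.
Qed.

Lemma fv_apps t s : fv (apps t s) = fv t ++ flatten (map fv s).
Proof.
elim: s t => [|u s IHs] t /=; first by rewrite cats0.
by rewrite IHs /= catA.
Qed.

Lemma subst_apps x u t s :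
  subst x u (apps t s) = apps (subst x u t) (map (subst x u) s).
Proof. by elim: s t => //= v s IHs t; rewrite IHs. Qed.

(** * Weak head reduction and standardization *)

(* The evaluation contexts are [E ::= [] | E u | if E then u else v]. *)
Inductive wh : pterm -> pterm -> Prop :=
  | WhBeta t u : lc (Lam t) -> lc u -> wh (App (Lam t) u) (open t u)
  | WhIfT u v : lc u -> lc v -> wh (If T u v) u
  | WhIfF u v : lc u -> lc v -> wh (If F u v) v
  | WhApp t t' u : wh t t' -> lc u -> wh (App t u) (App t' u)
  | WhIf t t' u v : wh t t' -> lc u -> lc v -> wh (If t u v) (If t' u v).

(** The presentation that exposes the first step suits arguments running backwards along a
    reduction, such as [wh_star_eval]. *)
Definition wh_star : pterm -> pterm -> Prop := clos_refl_trans_1n pterm wh.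

Lemma wh_lc t t' : wh t t' -> lc t /\ lc t'.
Proof.
elim=> {t t'} //=.
- by move=> t u lct lcu; split; [apply/andP | apply: lc_open].
- by move=> u v lcu lcv; split=> //; apply/and3P.
- by move=> u v lcu lcv; split=> //; apply/and3P.
- by move=> t t' u _ [lct lct'] lcu; split; apply/andP.
- by move=> t t' u v _ [lct lct'] lcu lcv; split; apply/and3P.
Qed.

Lemma wh_star_lc t t' : wh_star t t' -> lc t' -> lc t.
Proof. by case=> // u v /wh_lc[]. Qed.

Lemma wh_star_trans t u v : wh_star t u -> wh_star u v -> wh_star t v.
Proof.
by elim=> // x y z xy _ IH /IH; apply: Relation_Operators.rt1n_trans.
Qed.

Lemma wh_star1 t u : wh t u -> wh_star t u.
Proof. by move=> tu; apply: Relation_Operators.rt1n_trans tu _; constructor. Qed.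

Lemma wh_star_app t t' u : wh_star t t' -> lc u -> wh_star (App t u) (App t' u).
Proof.
move=> tt' lcu; elim: tt' => [x|x y z xy _ IH]; first by constructor.
by apply: Relation_Operators.rt1n_trans IH; apply: WhApp.
Qed.

Lemma wh_star_if t t' u v : wh_star t t' -> lc u -> lc v ->
  wh_star (If t u v) (If t' u v).
Proof.
move=> tt' lcu lcv; elim: tt' => [x|x y z xy _ IH]; first by constructor.
by apply: Relation_Operators.rt1n_trans IH; apply: WhIf.
Qed.

Lemma wh_subst x p t t' : lc p -> wh t t' -> wh (subst x p t) (subst x p t').
Proof.
move=> lcp; elim=> {t t'} /=.
- move=> t u lct lcu; rewrite subst_open //.
  by apply: WhBeta; [apply: (lc_subst x lcp lct) | apply: lc_subst].
- by move=> *; apply: WhIfT; apply: lc_subst.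
- by move=> *; apply: WhIfF; apply: lc_subst.
- by move=> *; apply: WhApp => //; apply: lc_subst.
- by move=> *; apply: WhIf => //; apply: lc_subst.
Qed.

Lemma wh_star_subst x p t t' : lc p -> wh_star t t' ->
  wh_star (subst x p t) (subst x p t').
Proof.
move=> lcp; elim=> [u|u v w uv _ IH]; first by constructor.
by apply: Relation_Operators.rt1n_trans IH; apply: wh_subst.
Qed.

(* [std t u]: there is a reduction from [t] to [u] that first performs weak
   head steps and then reduces the immediate subterms in the same manner. *)
Inductive std : pterm -> pterm -> Prop :=
  | StdVar t x : wh_star t (Var x) -> std t (Var x)
  | StdF t : wh_star t F -> std t F
  | StdT t : wh_star t T -> std t T
  | StdLam (L : seq var) t u u' : wh_star t (Lam u) ->
      (forall x, x \notin L -> std (open u (Var x)) (open u' (Var x))) ->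
      std t (Lam u')
  | StdApp t u u' v v' : wh_star t (App u v) ->
      std u u' -> std v v' -> std t (App u' v')
  | StdIf t u u' v v' w w' : wh_star t (If u v w) ->
      std u u' -> std v v' -> std w w' -> std t (If u' v' w').

Lemma std_lc t t' : std t t' -> lc t /\ lc t'.
Proof.
elim=> {t t'} /=.
- by move=> t x /wh_star_lc->.
- by move=> t /wh_star_lc->.
- by move=> t /wh_star_lc->.
- move=> L t u u' tu _ IH; have [lcu lcu'] := IH _ (new_notin L).
  split; last exact: lc_at_open_var lcu'.
  by apply: wh_star_lc tu _; apply: lc_at_open_var lcu.
- move=> t u u' v v' tuv _ [lcu lcu'] _ [lcv lcv'].
  by split; [apply: wh_star_lc tuv _|]; apply/andP.
- move=> t u u' v v' w w' tuvw _ [lcu lcu'] _ [lcv lcv'] _ [lcw lcw'].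
  by split; [apply: wh_star_lc tuvw _|]; apply/and3P.
Qed.

Lemma wh_star_std t u v : wh_star t u -> std u v -> std t v.
Proof.
move=> tu uv; case: uv tu => {u v}.
- by move=> u x ux tu; apply: StdVar; apply: wh_star_trans tu ux.
- by move=> u ux tu; apply: StdF; apply: wh_star_trans tu ux.
- by move=> u ux tu; apply: StdT; apply: wh_star_trans tu ux.
- move=> L u w w' uw ww' tu.
  by apply: (StdLam (L := L) (u := w)) => //; apply: wh_star_trans tu uw.
- move=> u w w' v v' uwv ww' vv' tu.
  by apply: (StdApp (u := w) (v := v)) => //; apply: wh_star_trans tu uwv.
- move=> u w w' v v' r r' uwv ww' vv' rr' tu.
  apply: (StdIf (u := w) (v := v) (w := r)) => //.
  exact: wh_star_trans tu uwv.
Qed.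

Fixpoint tsize (t : pterm) : nat :=
  match t with
  | Bvar _ | Var _ | F | T => 1
  | Lam t => (tsize t).+1
  | App t u => (tsize t + tsize u).+1
  | If t u v => (tsize t + tsize u + tsize v).+1
  end.

Lemma tsize_open_var k x t : tsize (open_at k (Var x) t) = tsize t.
Proof.
elim: t k => //=.
- by move=> n k; case: eqP.
- by move=> t IHt k; rewrite IHt.
- by move=> t IHt u IHu k; rewrite IHt IHu.
- by move=> t IHt u IHu v IHv k; rewrite IHt IHu IHv.
Qed.

(** The induction is on size, since an opened body is not a subterm of its abstraction; opening with
    a variable preserves [tsize]. *)
Lemma std_refl t : lc t -> std t t.
Proof.
have [n] := ubnP (tsize t); elim: n t => // n IHn [] //=.
- by move=> x _ _; apply: StdVar; constructor.
- by move=> _ _; apply: StdF; constructor.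
- by move=> _ _; apply: StdT; constructor.
- move=> t; rewrite ltnS => tn lct.
  apply: (StdLam (L := [::]) (u := t)) => [|x _]; first by constructor.
  by apply: IHn; [rewrite tsize_open_var | apply: lc_open].
- move=> t u; rewrite ltnS => tun /andP[lct lcu].
  apply: (StdApp (u := t) (v := u)); first by constructor.
    by apply: IHn => //; apply: leq_trans tun; rewrite ltnS leq_addr.
  by apply: IHn => //; apply: leq_trans tun; rewrite ltnS leq_addl.
- move=> t u v; rewrite ltnS => tuvn /and3P[lct lcu lcv].
  apply: (StdIf (u := t) (v := u) (w := v)); first by constructor.
  + by apply: IHn => //; apply: leq_trans tuvn; rewrite ltnS -addnA leq_addr.
  + by apply: IHn => //; apply: leq_trans tuvn; rewrite ltnS addnAC leq_addl.
  + by apply: IHn => //; apply: leq_trans tuvn; rewrite ltnS leq_addl.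
Qed.

Lemma std_subst x p p' t t' : std p p' -> std t t' ->
  std (subst x p t) (subst x p' t').
Proof.
move=> pp'; have [lcp lcp'] := std_lc pp'.
elim=> {t t'} /=.
- move=> t y /(wh_star_subst x lcp) /=.
  (* If [y] is [x], the substituted term reaches [p] by weak head steps, and these are prepended to
     the standard reduction from [p] to [p']. *)
  by case: eqP => [_ /wh_star_std|_]; [apply | apply: StdVar].
- by move=> t /(wh_star_subst x lcp); apply: StdF.
- by move=> t /(wh_star_subst x lcp); apply: StdT.
- move=> L t u u' /(wh_star_subst x lcp) tu _ IH.
  (* Excluding [x] as well keeps the opening name distinct from the substituted one, so substitution
     commutes with opening. *)
  apply: (StdLam (L := x :: L)) tu _ => y.
  rewrite inE negb_or eq_sym => /andP[xy yL].
  by rewrite -!subst_open_var //; apply: IH.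
- by move=> t u u' v v' /(wh_star_subst x lcp) tuv _ + _ +; apply: StdApp.
- by move=> t u u' v v' w w' /(wh_star_subst x lcp) tuv _ + _ + _ +; apply: StdIf.
Qed.

Lemma std_open (L : seq var) u u' v v' :
  (forall x, x \notin L -> std (open u (Var x)) (open u' (Var x))) ->
  std v v' -> std (open u v) (open u' v').
Proof.
move=> uu' vv'; have [lcv lcv'] := std_lc vv'.
have := new_notin (L ++ fv u ++ fv u').
set x := new _; rewrite !mem_cat !negb_or => /and3P[xL xu xu'].
rewrite (open_subst lcv xu) (open_subst lcv' xu').
by apply: std_subst vv' _; apply: uu'.
Qed.

(* Beta-delta reduction with a cofinite rule under abstractions, in place of
   the named one of [ctx_closure]. *)
Inductive red : pterm -> pterm -> Prop :=
  | RedBeta t u : lc (Lam t) -> lc u -> red (App (Lam t) u) (open t u)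
  | RedIfT u v : lc u -> lc v -> red (If T u v) u
  | RedIfF u v : lc u -> lc v -> red (If F u v) v
  | RedLam (L : seq var) t t' :
      (forall x, x \notin L -> red (open t (Var x)) (open t' (Var x))) ->
      red (Lam t) (Lam t')
  | RedAppL t t' u : red t t' -> lc u -> red (App t u) (App t' u)
  | RedAppR t u u' : lc t -> red u u' -> red (App t u) (App t u')
  | RedIf0 t t' u v : red t t' -> lc u -> lc v -> red (If t u v) (If t' u v)
  | RedIf1 t u u' v : lc t -> red u u' -> lc v -> red (If t u v) (If t u' v)
  | RedIf2 t u v v' : lc t -> lc u -> red v v' -> red (If t u v) (If t u v').

Lemma red_lc t t' : red t t' -> lc t /\ lc t'.
Proof.
elim=> {t t'} //=.
- by move=> t u lct lcu; split; [apply/andP | apply: lc_open].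
- by move=> u v lcu lcv; split=> //; apply/and3P.
- by move=> u v lcu lcv; split=> //; apply/and3P.
- move=> L t t' _ IH; have [lct lct'] := IH _ (new_notin L).
  by split; [apply: lc_at_open_var lct | apply: lc_at_open_var lct'].
- by move=> t t' u _ [lct lct'] lcu; split; apply/andP.
- by move=> t u u' lct _ [lcu lcu']; split; apply/andP.
- by move=> t t' u v _ [lct lct'] lcu lcv; split; apply/and3P.
- by move=> t u u' v lct _ [lcu lcu'] lcv; split; apply/and3P.
- by move=> t u v v' lct lcu _ [lcv lcv']; split; apply/and3P.
Qed.

Lemma red_subst x p t t' : lc p -> red t t' -> red (subst x p t) (subst x p t').
Proof.
move=> lcp; elim=> {t t'} /=.
- move=> t u lct lcu; rewrite subst_open //.
  by apply: RedBeta; [apply: (lc_subst x lcp lct) | apply: lc_subst].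
- by move=> *; apply: RedIfT; apply: lc_subst.
- by move=> *; apply: RedIfF; apply: lc_subst.
- move=> L t t' _ IH; apply: (RedLam (L := x :: L)) => y.
  rewrite inE negb_or eq_sym => /andP[xy yL].
  by rewrite -!subst_open_var //; apply: IH.
- by move=> *; apply: RedAppL => //; apply: lc_subst.
- by move=> *; apply: RedAppR => //; apply: lc_subst.
- by move=> *; apply: RedIf0 => //; apply: lc_subst.
- by move=> *; apply: RedIf1 => //; apply: lc_subst.
- by move=> *; apply: RedIf2 => //; apply: lc_subst.
Qed.

(** Opening the closed body with [z] renames [x] to [z], and reduction is stable under renaming;
    hence no name has to be excluded. *)
Lemma red_abs x t t' : red t t' -> red (abs x t) (abs x t').
Proof.
move=> tt'; have [lct lct'] := red_lc tt'.
apply: (RedLam (L := [::])) => z _.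
by rewrite !open_close //; apply: red_subst.
Qed.

Lemma ctx_closure_red (R : pterm -> pterm -> Prop) t t' :
  (forall u u', R u u' -> red u u') -> ctx_closure R t t' -> red t t'.
Proof.
move=> Rred; elim=> {t t'}.
- exact: Rred.
- by move=> *; apply: red_abs.
- by move=> *; apply: RedAppL.
- by move=> *; apply: RedAppR.
- by move=> *; apply: RedIf0.
- by move=> *; apply: RedIf1.
- by move=> *; apply: RedIf2.
Qed.

Lemma betadelta_red t t' : betadelta t t' -> red t t'.
Proof.
case; apply: ctx_closure_red => u u' [] *.
- exact: RedBeta.
- exact: RedIfT.
- exact: RedIfF.
Qed.

(** The heart of standardization: a further step is absorbed. For a contracted redex, inverting the
    standard reduction shows that [t] reaches a redex of the same form by weak head steps;
    contracting it is one more weak head step, after which the components continue standardly. Other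
    steps recurse into a component. *)
Lemma std_red t u u' : std t u -> red u u' -> std t u'.
Proof.
move=> tu uu'; elim: uu' t tu => {u u'}.
- move=> u' v' _ _ t tuv; inversion tuv as [| | | |? p ? v ? tpv pu vv'|]; subst.
  (* A standard reduction ending in an abstraction starts with weak head steps to an abstraction, so
     the function part of [t] becomes one before anything else reduces. *)
  inversion pu as [| | |L ? u ? pu_ uu'| |]; subst.
  apply: wh_star_std (std_open uu' vv').
  have [lcv _] := std_lc vv'; have [lcp _] := std_lc pu.
  apply: wh_star_trans tpv _; apply: wh_star_trans (wh_star_app pu_ lcv) _.
  apply: wh_star1; apply: WhBeta => //.
  by have [lcu _] := std_lc (uu' _ (new_notin L)); apply: lc_at_open_var lcu.
- move=> u' v' _ _ t tuv; inversion tuv as [| | | | |? c ? u ? v ? tif cT uu' vv'].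
  subst; inversion cT as [| |? cT'| | |]; subst.
  have [lcu _] := std_lc uu'; have [lcv _] := std_lc vv'.
  apply: wh_star_std uu'; apply: wh_star_trans tif _.
  apply: wh_star_trans (wh_star_if cT' lcu lcv) _.
  by apply: wh_star1; apply: WhIfT.
- move=> u' v' _ _ t tuv; inversion tuv as [| | | | |? c ? u ? v ? tif cF uu' vv'].
  subst; inversion cF as [|? cF'| | | |]; subst.
  have [lcu _] := std_lc uu'; have [lcv _] := std_lc vv'.
  apply: wh_star_std vv'; apply: wh_star_trans tif _.
  apply: wh_star_trans (wh_star_if cF' lcu lcv) _.
  by apply: wh_star1; apply: WhIfF.
- move=> L u u' _ IH t tu; inversion tu as [| | |L' ? w ? tw wu| |]; subst.
  apply: (StdLam (L := L ++ L')) tw _ => x.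
  by rewrite mem_cat negb_or => /andP[xL xL']; apply: IH => //; apply: wu.
- move=> u u' v _ IH _ t tuv; inversion tuv as [| | | |? p ? q ? tpq pu qv|]; subst.
  by apply: StdApp tpq _ qv; apply: IH.
- move=> u v v' _ _ IH t tuv; inversion tuv as [| | | |? p ? q ? tpq pu qv|]; subst.
  by apply: StdApp tpq pu _; apply: IH.
- move=> u u' v w _ IH _ _ t tuv.
  inversion tuv as [| | | | |? p ? q ? r ? tpqr pu qv rw]; subst.
  by apply: StdIf tpqr _ qv rw; apply: IH.
- move=> u v v' w _ _ IH _ t tuv.
  inversion tuv as [| | | | |? p ? q ? r ? tpqr pu qv rw]; subst.
  by apply: StdIf tpqr pu _ rw; apply: IH.
- move=> u v w w' _ _ _ IH t tuv.
  inversion tuv as [| | | | |? p ? q ? r ? tpqr pu qv rw]; subst.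
  by apply: StdIf tpqr pu qv _; apply: IH.
Qed.

Lemma std_betadelta_star t u u' : std t u -> betadelta_star u u' -> std t u'.
Proof.
move=> + uu'; elim: uu' t => {u u'} //.
- by move=> u u' /betadelta_red uu' t tu; apply: std_red uu'.
- by move=> u v w _ IH1 _ IH2 t /IH1 /IH2.
Qed.

(** A constant has no subterms, so a standard reduction to it consists of its weak head prefix. *)
Lemma betadelta_star_T_wh_star t : lc t -> betadelta_star t T -> wh_star t T.
Proof.
by move=> lct /(std_betadelta_star (std_refl lct)) tT; inversion tT.
Qed.

(** * Big-step evaluation *)

Definition const (b : answer) : pterm := if b is yes then T else F.

(** The rules keep the argument spine explicit, as the machine does; the condition of an if-term is
    evaluated on its own, without the spine. *)
Inductive eval : pterm -> answer -> Prop :=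
  | EvalConst b : eval (const b) b
  | EvalBeta N N1 s b : eval (apps (open N N1) s) b ->
      eval (apps (Lam N) (N1 :: s)) b
  | EvalIf M0 M1 M2 s a b : eval M0 a ->
      eval (apps (if a is yes then M1 else M2) s) b ->
      eval (apps (If M0 M1 M2) s) b.

Lemma eval_if_inv M0 M1 M2 s b : eval (apps (If M0 M1 M2) s) b ->
  exists2 a, eval M0 a & eval (apps (if a is yes then M1 else M2) s) b.
Proof.
move e : (apps (If M0 M1 M2) s) => t tb.
case: tb e => {t b}.
- by case=> /(@apps_inj _ s (const _) [::]) [].
- by move=> N N1 s' b _ /(@apps_inj _ s _ (N1 :: s')) [].
- move=> M0' M1' M2' s' a b ev0 ev /(@apps_inj _ s _ s') [] // [-> -> ->] ->.
  by exists a.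
Qed.

(** The spine [s] is generalized because a step under an application moves its argument onto the
    spine. *)
Lemma wh_eval t t' s b : wh t t' -> eval (apps t' s) b -> eval (apps t s) b.
Proof.
move=> tt'; elim: tt' s b => {t t'}.
- by move=> t u _ _ s b; apply: (@EvalBeta t u s).
- by move=> u v _ _ s b; apply: EvalIf (EvalConst yes).
- by move=> u v _ _ s b; apply: EvalIf (EvalConst no).
- by move=> t t' u _ IH _ s b; apply: (IH (u :: s)).
(* The reduced condition is evaluated separately, so the induction hypothesis is taken at the empty
   spine. *)
- move=> t t' u v _ IH _ _ s b /eval_if_inv[a t'a].
  by apply: EvalIf; apply: (IH [::]).
Qed.

Lemma wh_star_eval t b : wh_star t (const b) -> eval t b.
Proof.
move e : (const b) => c tc; elim: tc e => [x <-|x y z xy _ IH /IH yb].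
  exact: EvalConst.
exact: (@wh_eval _ _ [::]) xy yb.
Qed.

(** * Evaluation is realized by beta-delta reduction *)

Lemma betadelta_star_app t t' u : betadelta_star t t' -> lc u ->
  betadelta_star (App t u) (App t' u).
Proof.
move=> tt' lcu; elim: tt' => {t t'} [t t' tt'|t|t v w _ IH1 _ IH2].
- by apply: rt_step; case: tt' => tt'; [left|right]; apply: CcAppL.
- exact: rt_refl.
- exact: rt_trans IH2.
Qed.

Lemma betadelta_star_apps t t' s : betadelta_star t t' -> all lc s ->
  betadelta_star (apps t s) (apps t' s).
Proof.
elim: s t t' => //= u s IHs t t' tt' /andP[lcu lcs].
by apply: IHs => //; apply: betadelta_star_app.
Qed.

Lemma betadelta_star_if t t' u v : betadelta_star t t' -> lc u -> lc v ->
  betadelta_star (If t u v) (If t' u v).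
Proof.
move=> tt' lcu lcv; elim: tt' => {t t'} [t t' tt'|t|t w z _ IH1 _ IH2].
- by apply: rt_step; case: tt' => tt'; [left|right]; apply: CcIf0.
- exact: rt_refl.
- exact: rt_trans IH2.
Qed.

Lemma eval_betadelta_star t b : eval t b -> lc t -> betadelta_star t (const b).
Proof.
elim=> {t b} [b _|N N1 s b _ IH|M0 M1 M2 s a b _ IH0 _ IH].
- exact: rt_refl.
- rewrite lc_apps /= => /and3P[lcN lcN1 lcs].
  apply: rt_trans (IH _); last by rewrite lc_apps lc_open.
  apply: (@betadelta_star_apps (App (Lam N) N1)) => //.
  by apply: rt_step; left; apply: CcBase; apply: BetaRedex.
- rewrite lc_apps /= => /andP[/and3P[lc0 lc1 lc2] lcs].
  apply: rt_trans (IH _); last by rewrite lc_apps lcs andbT; case: a {IH0 IH}.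
  apply: betadelta_star_apps => //.
  apply: rt_trans (betadelta_star_if (IH0 lc0) lc1 lc2) _.
  apply: rt_step; right; apply: CcBase.
  by case: a {IH0 IH}; [apply: DeltaRedexT | apply: DeltaRedexF].
Qed.

(** * Unfolding of machine contexts *)

(* The later assignments are substituted first: the term assigned to a
   variable mentions only variables assigned before it. *)
Definition unfold (A : seq (var * pterm)) (t : pterm) : pterm :=
  foldr (fun a => subst a.1 a.2) t A.

(** Acyclicity of a context: when the assignments are substituted from the last to the first, no
    inserted term reintroduces a variable already eliminated. *)
Fixpoint scoped (A : seq (var * pterm)) : bool :=
  if A is (x, N) :: A' then
    [&& lc N, all (fun y => y \notin fv N) (x :: unzip1 A') & scoped A']
  else true.

Lemma unfold_cat A1 A2 t : unfold (A1 ++ A2) t = unfold A1 (unfold A2 t).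
Proof. exact: foldr_cat. Qed.

Lemma unfold_apps A t s : unfold A (apps t s) = apps (unfold A t) (map (unfold A) s).
Proof.
elim: A => /= [|a A IHA]; first by rewrite map_id.
by rewrite IHA subst_apps -map_comp.
Qed.

Lemma unfold_nonvar A t : ~~ is_var t ->
  unfold A t = match t with
               | Lam t => Lam (unfold A t)
               | App t u => App (unfold A t) (unfold A u)
               | If t u v => If (unfold A t) (unfold A u) (unfold A v)
               | _ => t
               end.
Proof. by case: t => // *; elim: A => //= a A ->. Qed.

Lemma unfold_open A t u : scoped A ->
  unfold A (open t u) = open (unfold A t) (unfold A u).
Proof. by elim: A => //= -[x N] A IHA /and3P[lcN _ /IHA->]; apply: subst_open. Qed.

Lemma unfold_fresh A t : all (fun y => y \notin fv t) (unzip1 A) -> unfold A t = t.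
Proof. by elim: A => //= a A IHA /andP[at_ /IHA->]; apply: subst_fresh. Qed.

Lemma unfold_var_notin A x : x \notin unzip1 A -> unfold A (Var x) = Var x.
Proof.
move=> xA; apply: unfold_fresh; apply/allP=> y yA; rewrite /= inE.
by apply: contraNneq xA => <-.
Qed.

Lemma scoped_mid A1 x N A2 : scoped (A1 ++ (x, N) :: A2) ->
  lc N /\ all (fun y => y \notin fv N) (x :: unzip1 A2).
Proof.
elim: A1 => [|[y P] A1 IHA1] /=; first by case/and3P.
by case/and3P=> _ _ /IHA1.
Qed.

(** This is the invariance under step (h). Distinctness makes [A2] leave [x] alone, and scoping
    makes [(x, N) :: A2] leave [N] alone; both sides are thus [unfold A1 N]. *)
Lemma unfold_var_assigned A1 x N A2 :
  uniq (unzip1 (A1 ++ (x, N) :: A2)) -> scoped (A1 ++ (x, N) :: A2) ->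
  unfold (A1 ++ (x, N) :: A2) (Var x) = unfold (A1 ++ (x, N) :: A2) N.
Proof.
rewrite /unzip1 map_cat cat_uniq /= => /and4P[_ _ xA2 _] /scoped_mid[_ frN].
rewrite !unfold_cat [in RHS](@unfold_fresh ((x, N) :: A2)) //=.
by rewrite unfold_var_notin //= eqxx.
Qed.

Lemma scoped_rcons (A : context) x N s t :
  fresh x A (apps t (N :: s)) -> lc N -> scoped A -> scoped (A ++ [:: (x, N)]).
Proof.
rewrite /fresh fv_apps /= !mem_cat !negb_or => /andP[/and3P[_ xN _]] frA lcN.
elim: (assigns A) frA => [_ _|[y P] B IHB] /=; first by rewrite lcN xN.
case/andP=> /andP[xy xP] frB /and3P[-> /andP[-> frP] /(IHB frB)->] /=.
by rewrite /unzip1 map_cat all_cat frP /= xP.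
Qed.

(** The new assignment comes last, so it is substituted first: by freshness it replaces exactly the
    opened occurrences of [x] and does not affect [s]. *)
Lemma unfold_beta (A : context) x N N1 s :
  fresh x A (apps (Lam N) (N1 :: s)) -> lc N1 ->
  unfold (A ++ [:: (x, N1)]) (apps (open N (Var x)) s)
    = unfold A (apps (open N N1) s).
Proof.
rewrite /fresh fv_apps /= !mem_cat !negb_or => /andP[/and3P[xN _ xs] _] lcN1.
rewrite unfold_cat /= subst_apps -open_subst //; congr (unfold A (apps _ _)).
elim: s xs => //= u s IHs; rewrite mem_cat negb_or => /andP[xu /IHs->].
by rewrite subst_fresh.
Qed.

(** * The machine *)

(** Scoping and closure are hypotheses, not conjuncts: acceptance is analysed from successors back
    to a configuration, while these invariants pass forward to the successors. *)
Definition config_eval (c : config) : Prop :=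
  match c with
  | Rejecting => False
  | Accepting => True
  | Ex A b t => scoped A -> lc t -> eval (unfold A t) b
  | Un A a t b u => scoped A -> lc t -> lc u ->
      eval (unfold A t) a /\ eval (unfold A u) b
  end.

Lemma step_config_eval c c' :
  existential c -> step c c' -> config_eval c' -> config_eval c.
Proof.
move=> + cc'; case: cc' => //=.
- move=> A A' b x N N1 s frx eA' _ IH scA; rewrite lc_apps.
  move=> /andP[/andP[lcN lcN1] lcs].
  rewrite unfold_apps unfold_nonvar //= unfold_nonvar //.
  apply: (@EvalBeta _ _ (map (unfold A) s)).
  (* Reading [unfold_beta] backwards turns the contractum into the unfolding, in the extended
     context, of the term of the successor configuration. *)
  rewrite -unfold_open // -unfold_apps -(unfold_beta frx) // -eA'; apply: IH.
    by rewrite eA'; apply: scoped_rcons frx _ _.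
  by rewrite lc_apps lc_open.
- move=> A A1 A2 x N b s eA _ IH scA; rewrite lc_apps => /= lcs.
  have := assigns_uniq A; rewrite unfold_apps.
  move: scA IH; rewrite eA => scA IH uA.
  rewrite unfold_var_assigned // -unfold_apps; apply: IH => //.
  by have [lcN _] := scoped_mid scA; rewrite lc_apps lcN.
- move=> A b M0 M1 M2 s _ IH scA.
  rewrite lc_apps /= => /andP[/and3P[lc0 lc1 lc2] lcs].
  have [|ev0 ev1] := IH scA lc0; first by rewrite lc_apps; apply/andP.
  by rewrite unfold_apps unfold_nonvar //; apply: EvalIf ev0 _; rewrite -unfold_apps.
- move=> A b M0 M1 M2 s _ IH scA.
  rewrite lc_apps /= => /andP[/and3P[lc0 lc1 lc2] lcs].
  have [|ev0 ev1] := IH scA lc0; first by rewrite lc_apps; apply/andP.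
  by rewrite unfold_apps unfold_nonvar //; apply: EvalIf ev0 _; rewrite -unfold_apps.
- by move=> A _ _ _ _; rewrite unfold_nonvar //; apply: (EvalConst yes).
- by move=> A _ _ _ _; rewrite unfold_nonvar //; apply: (EvalConst no).
Qed.

Lemma accepted_config_eval c : accepted c -> config_eval c.
Proof.
elim=> {c} // [c c' exc cc' _ IH|]; first exact: step_config_eval cc' IH.
case=> // A a t b u _ _ IH scA lct lcu.
by split; [apply: (IH _ (StepIf'L _ _ _ _ _)) | apply: (IH _ (StepIf'R _ _ _ _ _))].
Qed.

(** * Completeness of the machine for evaluation *)

Lemma accepted_Un A a t b u : accepted (Ex A a t) -> accepted (Ex A b u) ->
  accepted (Un A a t b u).
Proof.
move=> acct accu; apply: AccUniversal => // c' st.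
by inversion st; subst.
Qed.

(** The existential choice between the two (if) successors guesses the value [a] of the condition;
    the universal configuration then checks the guess and runs the matching branch. *)
Lemma accepted_If A a b M0 M1 M2 s : accepted (Ex A a M0) ->
  accepted (Ex A b (apps (if a is yes then M1 else M2) s)) ->
  accepted (Ex A b (apps (If M0 M1 M2) s)).
Proof.
move=> acc0 acc1; apply: AccExistential (accepted_Un acc0 acc1) => //.
by case: a {acc0 acc1}; [apply: StepIfYes | apply: StepIfNo].
Qed.

Lemma accepted_const A b : accepted (Ex A b (const b)).
Proof.
apply: AccExistential AccAccepting => //.
by case: b; [apply: StepYesT | apply: StepNoF].
Qed.

Lemma fresh_exists (A : context) t : exists x, fresh x A t.
Proof.
have := new_notin (fv t ++ unzip1 A ++ flatten (map (fv \o snd) A)).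
set x := new _; rewrite !mem_cat !negb_or => /and3P[xt xA xA'].
exists x; rewrite /fresh xt; apply/allP=> a aA; apply/andP; split.
  by apply: contraNneq xA => ->; apply: map_f.
apply: contraNN xA' => xa; apply/flatten_mapP.
by exists a.
Qed.

Lemma uniq_fresh_rcons (A : context) x N t :
  fresh x A t -> uniq (unzip1 (A ++ [:: (x, N)])).
Proof.
case/andP=> _ /allP frA; rewrite /unzip1 map_cat cat_uniq (assigns_uniq A) /=.
rewrite orbF andbT; apply/negP=> /mapP[a aA xa].
by case/andP: (frA a aA); rewrite xa eqxx.
Qed.

(** Hides the choice of the fresh name and the proof that the extended context still has distinct
    variables. *)
Lemma accepted_beta (A : context) b N N1 s :
  (forall (A' : context) x, fresh x A (apps (Lam N) (N1 :: s)) ->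
     assigns A' = A ++ [:: (x, N1)] ->
     accepted (Ex A' b (apps (open N (Var x)) s))) ->
  accepted (Ex A b (apps (Lam N) (N1 :: s))).
Proof.
move=> acc; have [x frx] := fresh_exists A (apps (Lam N) (N1 :: s)).
pose A' := Context (uniq_fresh_rcons N1 frx).
by apply: AccExistential (acc A' x frx (erefl _)) => //; apply: StepBeta.
Qed.

(* Steps (h) terminate because each one moves the head variable to an earlier
   assignment; [m] bounds the position of the assignment of the head variable. *)
Lemma accepted_head (A : context) t b : scoped A -> lc t ->
  ~~ is_var (term_head (unfold A t)) ->
  (forall t', unfold A t' = unfold A t -> lc t' -> ~~ is_var (term_head t') ->
     accepted (Ex A b t')) ->
  accepted (Ex A b t).
Proof.
move=> scA lct nvar acc.
(* Invariant for the bound: a head variable is not assigned at position [m] or later. It holds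
   vacuously at [m = size A]. *)
have : forall x, term_head t = Var x -> x \notin unzip1 (drop (size A) A).
  by rewrite drop_size.
move: {1}(size A) => m; have [n] := ubnP m.
elim: n m t lct nvar acc => // n IHn m t; rewrite ltnS.
move=> lct nvar acc mn scopet.
have [hv|] := boolP (is_var (term_head t)); last exact: acc.
have [x hx] : exists x, term_head t = Var x.
  by case: (term_head t) hv => // x; exists x.
have et := apps_head_args t; rewrite hx in et.
move: (term_args t) et => s et; subst t.
move: lct; rewrite lc_apps => /= lcs.
have [xA|xA] := boolP (x \in unzip1 A); last first.
  (* An unassigned head variable would survive unfolding, against [nvar]. *)
  by move: nvar; rewrite unfold_apps unfold_var_notin // head_apps.
have [N xN] : exists N, (x, N) \in assigns A.
  by case/mapP: xA => -[y N] /= yN ->; exists N.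
have [A1 [A2 eA]] : exists A1 A2, assigns A = A1 ++ (x, N) :: A2.
  by case/splitPr: xN => A1 A2; exists A1, A2.
have scA' := scA; have uA := assigns_uniq A; rewrite eA in scA' uA.
have [lcN frN] := scoped_mid scA'.
have eN : unfold A (apps N s) = unfold A (apps (Var x) s).
  by rewrite !unfold_apps eA unfold_var_assigned.
apply: AccExistential (StepH _ _ eA) _ => //.
(* By scoping [N] mentions neither [x] nor a later variable, so a head variable of [N] can only be
   assigned within [A1]. *)
apply: (IHn (size A1)) => //.
- by rewrite lc_apps lcN.
- by rewrite eN.
- by rewrite eN.
- apply: leq_trans mn; rewrite ltnNge; apply/negP => mA1.
  have := scopet x; rewrite head_apps => /(_ (erefl _)) /negP; apply.
  rewrite eA drop_cat; case: ltnP => _.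
    by rewrite /unzip1 map_cat mem_cat /= inE eqxx orbT.
  (* The inequality [m <= size A1] is by definition [m - size A1 == 0], so nothing is dropped from
     the part that begins with [x]. *)
  by rewrite (eqP mA1) drop0 inE eqxx.
- move=> y; rewrite head_apps => hy.
  rewrite eA drop_size_cat //; apply/negP=> /(allP frN).
  by rewrite -(apps_head_args N) hy fv_apps inE eqxx.
Qed.

(** With a head that is not a variable, unfolding acts on head and arguments separately and creates
    no new application at the head, so the two spines match. *)
Lemma unfold_apps_inv A t h s :
  ~~ is_app h -> ~~ is_var (term_head t) -> unfold A t = apps h s ->
  exists h' s', [/\ t = apps h' s', ~~ is_var h', unfold A h' = h &
                   map (unfold A) s' = s].
Proof.
move=> nh nv e; exists (term_head t), (term_args t).
move: e; rewrite -{1}(apps_head_args t) unfold_apps => /apps_inj[] //.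
  by rewrite unfold_nonvar //; case: (term_head t) (head_not_app t).
by rewrite apps_head_args.
Qed.

(** Induction on the evaluation, for all contexts and terms representing [t], since a beta step
    extends the context. Each case first runs (h) steps until the head constructor is that of [t],
    then makes the matching transition. *)
Lemma eval_accepted t b : eval t b -> forall (A : context) u,
  scoped A -> lc u -> unfold A u = t -> accepted (Ex A b u).
Proof.
elim=> {t b} [b|N N1 s b _ IH|M0 M1 M2 s a b _ IH0 _ IH] A u scA lcu eu.
- apply: accepted_head => //; first by rewrite eu; case: (b).
  move=> t; rewrite eu => et lct nv.
  have [|h [s [eth nh eh es]]] := @unfold_apps_inv A t (const b) [::] _ nv et.
    by case: (b).
  case: s es eth => // _ ->; rewrite unfold_nonvar // in eh.
  suff -> : h = const b by apply: accepted_const.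
  by move: eh nh; case: h; case: (b).
- apply: accepted_head => //; first by rewrite eu head_apps.
  move=> t; rewrite eu => et lct nv.
  have [//|h [s' [eth nh eh es]]] := @unfold_apps_inv A t (Lam N) (N1 :: s) _ nv et.
  rewrite unfold_nonvar // in eh; case: h eh nh eth => // N' [eN] _.
  case: s' es => // N1' s' [eN1 es] eth.
  move: lct; rewrite eth lc_apps => /and3P[lcN lcN1 lcs].
  apply: accepted_beta => A' x frx eA'; apply: IH.
  + by rewrite eA'; apply: scoped_rcons frx _ _.
  + by rewrite lc_apps lc_open.
  + by rewrite eA' unfold_beta // unfold_apps unfold_open // eN eN1 es.
- apply: accepted_head => //; first by rewrite eu head_apps.
  move=> t; rewrite eu => et lct nv.
  have [//|h [s' [eth nh eh es]]] := @unfold_apps_inv A t (If M0 M1 M2) s _ nv et.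
  rewrite unfold_nonvar // in eh; case: h eh nh eth => // P0 P1 P2 [e0 e1 e2] _ eth.
  move: lct; rewrite eth lc_apps => /andP[/and3P[lc0 lc1 lc2] lcs].
  apply: (accepted_If (a := a)); first exact: IH0.
  apply: IH => //; first by rewrite lc_apps lcs andbT; case: (a).
  by rewrite unfold_apps es; case: (a); rewrite ?e1 ?e2.
Qed.

Lemma machine_accepts_eval M : lc M -> machine_accepts M <-> eval M yes.
Proof.
move=> lcM; split=> [acc|ev]; first exact: (accepted_config_eval acc).
exact: eval_accepted ev _ _ _ _ _.
Qed.

Lemma normal_T : normal T.
Proof. by move=> u [] r; inversion r as [? ? b| | | | | |]; inversion b. Qed.

Theorem theorem6 (M : pterm) (hM : program M) :
  machine_accepts M <-> is_normal_form_of T M.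
Proof.
have [n /typing_lc lcM] := hM.
split=> [/(machine_accepts_eval lcM) ev|[redM _]].
  by split; [apply: (eval_betadelta_star ev) | apply: normal_T].
apply/(machine_accepts_eval lcM)/(@wh_star_eval _ yes).
exact: betadelta_star_T_wh_star.
Qed.
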